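(* Let $m\geqslant 3$ and $n\geqslant 1$. Let $C_m$ be the cycle graph with vertices $v_0,\dots,v_{m-1}$ and edges $\{v_i,v_{i+1}\}$ ($0\le i\le m-2$) and $\{v_{m-1},v_0\}$, let $P_n$ be the path graph with vertices $v_0',\dots,v_{n-1}'$ and edges $\{v_j',v_{j+1}'\}$ ($0\le j\le n-2$), and let $\phi_{n,m}:P_n\to C_m$ be the map of graphs $\phi_{n,m}(v_j')=v_{j\bmod m}$. Then $\phi_{n,m}^*:G(C_m)\to G(P_n)$ is injective if and only if $n\geqslant 2m-2$.
   Context: For a graph $\Gamma$, $G(\Gamma)$ is the group with generating set $V(\Gamma)$ and relations $[u,v]=1$ whenever $\{u,v\}$ is NOT an edge of $\Gamma$. A map of graphs $\phi:\Lambda\to\Gamma$ (vertices to vertices, adjacent to adjacent) induces the homomorphism $\phi^*:G(\Gamma)\to G(\Lambda)$, $\phi^*(v)=\prod_{v'\in\phi^{-1}(v)}v'$ (identity if the fiber is empty; the factors pairwise commute). *)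

(* Defs.v *)
From mathcomp Require Import all_boot.
Set Implicit Arguments. Unset Strict Implicit. Unset Printing Implicit Defensive.

(* Words in the generators V(Gamma) and their inverses: a letter (v, false)
   is v, a letter (v, true) is v^-1. *)
Definition word (V : Type) := seq (V * bool).

Definition inv_word (V : Type) (w : word V) : word V :=
  rev [seq (x.1, ~~ x.2) | x <- w].

Definition commutator_word (V : Type) (u v : V) : word V :=
  [:: (u, false); (v, false); (u, true); (v, true)].

(* G(Gamma) = < V | [u,v] = 1 whenever {u,v} is NOT an edge >.
   Two words represent the same element of G(Gamma) iff they are related by
   the smallest equivalence relation containing free cancellation and the
   insertion/deletion of a defining relator (i.e. the usual presentation
   congruence). *)
Inductive geq (V : finType) (e : rel V) : word V -> word V -> Prop :=
| geq_refl w : geq e w w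
| geq_sym w1 w2 : geq e w1 w2 -> geq e w2 w1
| geq_trans w1 w2 w3 : geq e w1 w2 -> geq e w2 w3 -> geq e w1 w3
| geq_free (u w : word V) (x : V) (b : bool) :
    geq e (u ++ (x, b) :: (x, ~~ b) :: w) (u ++ w)
| geq_rel (u w : word V) (x y : V) :
    ~~ e x y -> geq e (u ++ commutator_word x y ++ w) (u ++ w).

(* For a map of graphs phi : Lambda -> Gamma, the induced homomorphism
   phi^* : G(Gamma) -> G(Lambda), v |-> prod_{v' in phi^-1(v)} v',
   given on words (v^-1 goes to the inverse of that product). *)
Definition phistar_letter (VL VG : finType) (phi : VL -> VG) (x : VG * bool)
  : word VL :=
  let p := [seq (v', false) | v' <- enum [pred v' | phi v' == x.1]] in
  if x.2 then inv_word p else p.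

Definition phistar (VL VG : finType) (phi : VL -> VG) (w : word VG) : word VL :=
  flatten [seq phistar_letter phi x | x <- w].

Definition phistar_injective (VL VG : finType) (eL : rel VL) (eG : rel VG)
  (phi : VL -> VG) : Prop :=
  forall w1 w2 : word VG, geq eL (phistar phi w1) (phistar phi w2) -> geq eG w1 w2.

Definition graph_map (VL VG : finType) (eL : rel VL) (eG : rel VG)
  (phi : VL -> VG) : Prop := forall x y, eL x y -> eG (phi x) (phi y).

Definition cycle_rel (m : nat) : rel 'I_m :=
  fun i j => (val j == i.+1 %% m) || (val i == j.+1 %% m).

Definition path_rel (n : nat) : rel 'I_n :=
  fun i j => (val j == i.+1) || (val i == j.+1).

Definition phi_nm (n m : nat) (hm : 0 < m) (j : 'I_n) : 'I_m :=
  Ordinal (ltn_pmod j hm).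

Arguments cycle_rel m : clear implicits.
Arguments path_rel n : clear implicits.
Arguments phi_nm n m hm j : clear implicits.

(* Main.v *)
From mathcomp Require Import all_boot zify.
Require Import Defs.
Set Implicit Arguments. Unset Strict Implicit. Unset Printing Implicit Defensive.

(* Injectivity for n >= 2m - 2. If phi^*(w) = 1, its letters can be matched in
   cancelling pairs so that the pairs of equal or adjacent path vertices do not
   cross; each pair (an "arc") projects to two inverse letters of w. Suppose no
   two letters of w cancel directly. An arc of v'_(m-2) over no v_(m-1) must then
   enclose an arc of v'_(m-3), which encloses one of v'_(m-4), and so on, until an
   arc of v'_0 encloses neither v_1 nor v_(m-1), so that its ends do cancel in w.
   The mirror chain v'_(m-1), ..., v'_(2m-3) handles the arcs of v'_(m-1) over no
   v_(m-2). Hence w <> 1 always has a cancelling pair, and one inducts on length.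

   Failure for n <= 2m - 3. The commutator [v_(m-3), [..., [v_0, v_(m-1)]]] maps
   to 1: inductively the image of the inner commutator involves only
   v'_(m-1), ..., v'_(2m-4), which v'_(m-3), the only lift of v_(m-3), commutes
   with. It is nontrivial because, killing v_(m-2), the remaining generators act
   on bit vectors by elementary transvections along the path v_(m-1), v_0, ... *)

(** Locates two marked letters of one word relative to each other; the case analyses on cancelling
    words below rest on it. *)
Lemma eq_cat_cons (T : Type) (u u' v v' : seq T) (x y : T) :
  u ++ x :: v = u' ++ y :: v' ->
  [\/ [/\ u = u', x = y & v = v'],
      exists2 k, u' = u ++ x :: k & v = k ++ y :: v'
    | exists2 k, u = u' ++ y :: k & v' = k ++ x :: v].
Proof.
elim: u u' => [|a u IH] [|a' u'] /=.
- by case=> -> ->; constructor 1.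
- by case=> -> ->; constructor 2; exists u'.
- by case=> <- <-; constructor 3; exists u.
- case=> <- /IH [[-> -> ->]|[k -> ->]|[k -> ->]].
  + by constructor 1.
  + by constructor 2; exists k.
  + by constructor 3; exists k.
Qed.

Lemma inv_word_cat (V : Type) (w1 w2 : word V) :
  inv_word (w1 ++ w2) = inv_word w2 ++ inv_word w1.
Proof. by rewrite /inv_word map_cat rev_cat. Qed.

(** * Calculus of words in [G(Gamma)] *)

Section Presentation.
Variables (V : finType) (e : rel V).
Implicit Types (u v w : word V) (x y : V).

Lemma geq_cat2 u w w1 w2 : geq e w1 w2 -> geq e (u ++ w1 ++ w) (u ++ w2 ++ w).
Proof.
elim=> [w0|a b _|a b c _ IH1 _|u1 t x b|u1 t x y exy].
- exact: geq_refl.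
- exact: geq_sym.
- exact: geq_trans IH1.
- by rewrite -!catA !cat_cons catA [u ++ _ ++ _]catA; apply: geq_free.
- by rewrite -!catA catA [u ++ u1 ++ t ++ w]catA; apply: geq_rel.
Qed.

Lemma geq_catl u w1 w2 : geq e w1 w2 -> geq e (u ++ w1) (u ++ w2).
Proof. by move=> /(geq_cat2 u [::]); rewrite !cats0. Qed.

Lemma geq_catr u w1 w2 : geq e w1 w2 -> geq e (w1 ++ u) (w2 ++ u).
Proof. exact: (geq_cat2 [::]). Qed.

Lemma geq_cat u1 u2 w1 w2 :
  geq e u1 u2 -> geq e w1 w2 -> geq e (u1 ++ w1) (u2 ++ w2).
Proof. by move=> h1 /(geq_catl u2); apply: geq_trans; apply: geq_catr. Qed.

Lemma inv_wordK : involutive (@inv_word V).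
Proof.
move=> w; rewrite /inv_word map_rev revK -map_comp -[RHS]map_id.
by apply: eq_map => -[x b] /=; rewrite negbK.
Qed.

Lemma inv_word_cons x b w : inv_word ((x, b) :: w) = inv_word w ++ [:: (x, ~~ b)].
Proof. by rewrite /inv_word /= rev_cons cats1. Qed.

Lemma geq_mulV w : geq e (w ++ inv_word w) [::].
Proof.
elim: w => [|[x b] w IH]; first exact: geq_refl.
rewrite inv_word_cons catA.
exact: geq_trans (geq_cat2 [:: (x, b)] [:: (x, ~~ b)] IH) (geq_free _ [::] [::] x b).
Qed.

Lemma geq_Vmul w : geq e (inv_word w ++ w) [::].
Proof. by have := geq_mulV (inv_word w); rewrite inv_wordK. Qed.

Lemma geq_inv w1 w2 : geq e w1 w2 -> geq e (inv_word w1) (inv_word w2).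
Proof.
move=> h; apply: (@geq_trans _ _ _ (inv_word w1 ++ (w2 ++ inv_word w2))).
  rewrite -{1}[inv_word w1]cats0; apply/geq_catl/geq_sym/geq_mulV.
rewrite catA -[X in geq _ _ X]cat0s; apply: geq_catr.
by apply: geq_trans (geq_Vmul w1); apply/geq_catl/geq_sym.
Qed.

Lemma geq_eq1 w1 w2 : geq e (w1 ++ inv_word w2) [::] -> geq e w1 w2.
Proof.
move=> h; apply: (@geq_trans _ _ _ (w1 ++ (inv_word w2 ++ w2))).
  by rewrite -{1}[w1]cats0; apply/geq_catl/geq_sym/geq_Vmul.
by rewrite catA -[X in geq _ _ X]cat0s; apply: geq_catr.
Qed.

Let geq_swap_conj x b (z : V * bool) : 
  geq e [:: (x, b); z] [:: z; (x, b)] -> geq e [:: (x, ~~ b); z] [:: z; (x, ~~ b)].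
Proof.
move=> h; apply: (@geq_trans _ _ _ [:: (x, ~~ b); z; (x, b); (x, ~~ b)]).
  exact/geq_sym/(geq_free _ [:: (x, ~~ b); z] [::]).
apply: (@geq_trans _ _ _ [:: (x, ~~ b); (x, b); z; (x, ~~ b)]).
  exact/geq_sym/(geq_cat2 [:: (x, ~~ b)] [:: (x, ~~ b)] h).
by have := geq_free e [::] [:: z; (x, ~~ b)] x (~~ b); rewrite negbK.
Qed.

(** The relator makes the positive letters commute; conjugation by a letter then inverts one of them
    at a time. *)
Lemma geq_swap x y b c : ~~ e x y ->
  geq e [:: (x, b); (y, c)] [:: (y, c); (x, b)].
Proof.
move=> exy; have h : geq e [:: (x, false); (y, false)] [:: (y, false); (x, false)].
  apply: geq_trans (geq_rel [::] [:: (y, false); (x, false)] exy).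
  apply: (@geq_trans _ _ _ ([:: (x, false); (y, false); (x, true)] ++ [:: (x, false)])).
    exact/geq_sym/(geq_free e [:: (x, false); (y, false)] [::] x true).
  exact/geq_sym/(geq_free e [:: (x, false); (y, false); (x, true)] [:: (x, false)] y true).
have hx d : geq e [:: (x, d); (y, false)] [:: (y, false); (x, d)].
  by case: d => //; apply: (geq_swap_conj h).
case: c => //; exact/geq_sym/(geq_swap_conj (geq_sym (hx b))).
Qed.

Lemma geq_conj1 x b w : all (fun z => ~~ e x z.1) w ->
  geq e ((x, b) :: w ++ [:: (x, ~~ b)]) w.
Proof.
elim: w => [_|[y c] w IH /= /andP[exy /IH h]]; first exact: (geq_free _ [::] [::]).
apply: geq_trans (geq_catl [:: (y, c)] h).
exact: (geq_catr (w ++ [:: (x, ~~ b)]) (geq_swap b c exy)).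
Qed.

Lemma geq_conj (a w : word V) : all (fun p => all (fun q => ~~ e p.1 q.1) w) a ->
  geq e (a ++ w ++ inv_word a) w.
Proof.
elim: a => [_|[x b] a IH /= /andP[hx /IH h]]; first by rewrite cats0; apply: geq_refl.
rewrite inv_word_cons !catA -(catA a).
exact: geq_trans (geq_cat2 [:: (x, b)] [:: (x, ~~ b)] h) (geq_conj1 b hx).
Qed.

End Presentation.

(** * Cancellation in matched pairs *)

Section Cancellation.
Variables (V : finType) (e : rel V).
Hypothesis e_sym : symmetric e.

(** Equality is excluded although a letter commutes with itself, so that two pairs over the same
    vertex cannot cross either. *)
Definition indep (x y : V) := (x != y) && ~~ e x y.

Lemma indep_sym : symmetric indep.
Proof. by move=> x y; rewrite /indep eq_sym e_sym. Qed.

Lemma indepxx x : indep x x = false.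
Proof. by rewrite /indep eqxx. Qed.

(** Read backwards, a derivation removes one pair at a time; [v] holds the letters between its ends
    that are still present at its removal. *)
Inductive cancels : word V -> Prop :=
| cancels_nil : cancels [::]
| cancels_pair u v t x b : all (fun y => indep x y.1) v ->
    cancels (u ++ v ++ t) -> cancels (u ++ (x, b) :: v ++ (x, ~~ b) :: t).

Lemma cancels_pairE W u v t x b : W = u ++ (x, b) :: v ++ (x, ~~ b) :: t ->
  all (fun y => indep x y.1) v -> cancels (u ++ v ++ t) -> cancels W.
Proof. by move=> ->; apply: cancels_pair. Qed.

Ltac cat_assoc := by do ?rewrite -?catA /=.

(** Induction on the derivation. If one swapped letter is an end of the outermost pair, the other
    enters or leaves the span of that pair, which independence permits; the two cannot be both ends,
    as [indep] is irreflexive. *)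
Lemma cancels_swap (u t : word V) a c : indep a.1 c.1 ->
  cancels (u ++ a :: c :: t) -> cancels (u ++ c :: a :: t).
Proof.
move=> hac; move: {-2}(u ++ _) (erefl (u ++ a :: c :: t)) => W eqW hW.
elim: hW u t eqW => [|u v t x b hv hW IH] u2 t2 eqW; first by case: u2 eqW.
have := eq_cat_cons (esym eqW); case=> [[eu ea et]|[k eu et]|[k ek et]].
- subst u; case: v hv hW IH et {eqW} => [|z v] /= hv hW IH [ez et].
    by rewrite ea ez indepxx in hac.
  case/andP: hv => hz hv; subst.
  by apply: (@cancels_pairE _ (u2 ++ [:: z]) v t x b); rewrite -?catA.
- subst u; case: k et hW IH {eqW} => [|c' k] [ec ->] hW IH; last first.
    apply: (@cancels_pairE _ (u2 ++ c :: a :: k) v t x b) => //; first cat_assoc.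
    by rewrite -catA /=; apply: IH; subst; cat_assoc.
  subst; apply: (@cancels_pairE _ u2 (a :: v) t x b) => //=.
    by rewrite hv indep_sym hac.
  by rewrite -catA in hW.
- subst u2; clear eqW; have := eq_cat_cons et; case=> [[ek ea {}et]|[k2 ek {}et]|[k2 ek {}et]]; subst.
  + apply: (@cancels_pairE _ u (k ++ [:: c]) t2 x b) => //; first cat_assoc.
    * by rewrite all_cat hv /= hac.
    * by move: hW; do ?rewrite -?catA /=.
  + apply: (@cancels_pairE _ u v (k2 ++ c :: a :: t2) x b) => //; first cat_assoc.
    by rewrite !catA; apply: IH; cat_assoc.
  + move: hv; rewrite all_cat /= => /and3P[hk ha hk2].
    case: k2 et hk2 hW IH => [|c' k2] /= [ec et] hk2 hW IH; subst.
      apply: (@cancels_pairE _ u k (a :: t) x b) => //; first cat_assoc.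
      by move: hW; do ?rewrite -?catA /=.
    case/andP: hk2 => hc hk2.
    apply: (@cancels_pairE _ u (k ++ c' :: a :: k2) t x b) => //; first cat_assoc.
      by rewrite all_cat /= hk hc ha.
    by do ?rewrite -?catA /=; rewrite catA; apply: IH; cat_assoc.
Qed.

Lemma cancels_move (u v t : word V) y : all (fun z => indep y.1 z.1) v ->
  cancels (u ++ y :: v ++ t) <-> cancels (u ++ v ++ y :: t).
Proof.
elim: v u => [|z v IH] u //= /andP[hz hv].
have := IH (u ++ [:: z]) hv; rewrite -!catA /= => <-.
by split; apply: cancels_swap; rewrite // indep_sym.
Qed.

Lemma cancels_del (u t : word V) x b :
  cancels (u ++ (x, b) :: (x, ~~ b) :: t) -> cancels (u ++ t).
Proof.
move: {-2}(u ++ _) (erefl (u ++ (x, b) :: (x, ~~ b) :: t)) => W eqW hW.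
elim: hW u t eqW => [|u v t y c hv hW IH] u2 t2 eqW; first by case: u2 eqW.
have := eq_cat_cons (esym eqW); case=> [[eu ea et]|[k eu et]|[k ek et]].
- case: ea => ? ?; subst u2 y c; clear eqW.
  case: v hv hW IH et => [|z v] /= hv hW IH; first by case=> ->.
  case=> ez _; by case/andP: hv; rewrite -ez /= indepxx.
- subst u; case: k et hW IH {eqW} => [|z k]; last first.
    case=> ec et hW IH; subst; apply: (@cancels_pairE _ (u2 ++ k) v t y c) => //; first cat_assoc.
    by rewrite -catA /=; apply: IH; subst; cat_assoc.
  (* Only the second deleted letter belongs to the outermost pair. The first has the same sign as
     the far end of that pair, so it slides across [v] and takes its place. *)
  case=> ? ? ? hW IH; subst x c t2; rewrite negbK.
  move: hW; rewrite -catA /=.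
  by move/(cancels_move u2 t (y := (y, b)) hv).
- subst u2; clear eqW; have := eq_cat_cons et; case=> [[ek ea {}et]|[k2 ek {}et]|[k2 ek {}et]]; subst.
  + case: ea => ? ?; subst; rewrite negbK in hW IH *.
    by move: hW; rewrite -catA /= => /(cancels_move u t2 (y := (x, c)) hv).
  + apply: (@cancels_pairE _ u v (k2 ++ t2) y c) => //; first cat_assoc.
    by rewrite !catA; apply: IH; cat_assoc.
  + move: hv; rewrite all_cat /= => /and3P[hk ha hk2].
    case: k2 et hk2 hW IH => [|c' k2] /=; first by case=> ec; rewrite ec indepxx in ha.
    case=> ec et /andP[hc hk2] hW IH; subst.
    apply: (@cancels_pairE _ u (k ++ k2) t y c) => //; first cat_assoc.
      by rewrite all_cat hk.
    by rewrite -(catA k) catA; apply: IH; cat_assoc.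
Qed.

Lemma cancels_ins (u t : word V) x b :
  cancels (u ++ t) -> cancels (u ++ (x, b) :: (x, ~~ b) :: t).
Proof. exact: (@cancels_pair u [::]). Qed.

(** The empty word cancels, so every word representing the identity does: this extracts a matching
    from an equality in the group. *)
Lemma cancels_geq w1 w2 : geq e w1 w2 -> cancels w1 <-> cancels w2.
Proof.
elim=> {w1 w2} [w|w1 w2 _ [h1 h2]|w1 w2 w3 _ [h1 h2] _ [h3 h4]|u w x b|u w x y exy].
- by [].
- by split.
- by split; auto.
- by split; [apply: cancels_del | apply: cancels_ins].
rewrite /commutator_word /=; split=> [h|h].
  (* For [x = y] the letters are not independent, but the relator [x x x^-1 x^-1] cancels freely. *)
  have [exy'|nxy] := eqVneq x y.
    subst y; apply: (@cancels_del _ _ x false).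
    by have := @cancels_del (u ++ [:: (x, false)]) ((x, true) :: w) x false; rewrite -!catA; apply.
  apply: (@cancels_del _ _ y false); apply: (@cancels_del _ _ x false).
  have := @cancels_swap (u ++ [:: (x, false)]) ((y, true) :: w) (y, false) (x, true).
  by rewrite -!catA /= indep_sym /indep nxy exy; apply.
have [exy'|nxy] := eqVneq x y.
  subst y.
  have := @cancels_ins (u ++ [:: (x, false)]) ((x, true) :: w) x false.
  by rewrite -!catA; apply; apply: cancels_ins.
have := @cancels_swap (u ++ [:: (x, false)]) ((y, true) :: w) (x, true) (y, false).
rewrite -!catA /= /indep nxy exy; apply => //.
by do 2 apply: cancels_ins.
Qed.

End Cancellation.

(** * Non-crossing arcs *)

Lemma map_eq_cat (T U : Type) (f : T -> U) s u v : map f s = u ++ v ->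
  exists s1 s2, [/\ s = s1 ++ s2, map f s1 = u & map f s2 = v].
Proof.
move=> h; exists (take (size u) s), (drop (size u) s).
by rewrite cat_take_drop map_take map_drop h take_size_cat ?drop_size_cat.
Qed.

Section Arcs.
Variables (V : finType) (e : rel V).
Hypothesis e_sym : symmetric e.

(* [tw] is a word with time-stamped letters; [A x s t] says that the letters of
   vertex [x] at times [s] and [t] are matched with each other. *)
Definition arc_system (tw : seq (nat * (V * bool))) (A : V -> nat -> nat -> Prop) :=
  [/\ forall k x b, (k, (x, b)) \in tw -> exists s t, A x s t /\ (k = s \/ k = t),
      forall x s t, A x s t -> exists b,
        [/\ (s, (x, b)) \in tw, (t, (x, ~~ b)) \in tw & s <= t]
    & forall x y s t s' t', ~~ indep e x y -> A x s t -> A y s' t' ->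
        ~ (s < s' < t /\ t < t')].

(** Each removed pair becomes an arc from [i] to [j]. The remaining letters between its ends are
    independent of [x], so arcs over equal or adjacent vertices have their ends at times at most [i]
    or at least [j]. Stamps may repeat, hence the strict inequalities in the crossing condition. *)
Lemma cancels_arc_system (W : word V) : cancels e W ->
  forall tw, [seq p.2 | p <- tw] = W -> pairwise (fun p q => p.1 <= q.1) tw ->
  exists A, arc_system tw A.
Proof.
elim=> [|u v t x b hv _ IH] tw.
  by case: tw => //= _ _; exists (fun _ _ _ => False); split.
case/map_eq_cat => [U [tw1 [-> hU]]]; case: tw1 => [//|[i _] tw1] /= [-> h2].
case/map_eq_cat: h2 => [Vv [tw2 [-> hV]]]; case: tw2 => [//|[j _] T] /= [-> hT].
have inV k y c : (k, (y, c)) \in Vv -> indep e x y.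
  by move=> /(map_f snd); rewrite hV => /(allP hv).
move=> srt; have subs : subseq (U ++ Vv ++ T) (U ++ (i, (x, b)) :: Vv ++ (j, (x, ~~ b)) :: T).
  apply/(cat_subseq (subseq_refl U))/(subseq_trans _ (subseq_cons _ _)).
  exact/(cat_subseq (subseq_refl Vv))/subseq_cons.
have sub := mem_subseq subs.
have [|A [A1 A2 A3]] := IH (U ++ Vv ++ T) _ (subseq_pairwise subs srt).
  by rewrite !map_cat hU hV hT.
move: srt; rewrite pairwise_cat allrel_consr /= pairwise_cat all_cat /= => /and4P[].
case/andP=> Ui _ _ /and3P[_ ij _] /and3P[_ _ /andP[jT _]].
have endp k y c : (k, (y, c)) \in U ++ Vv ++ T -> ~~ indep e x y -> k <= i \/ j <= k.
  rewrite !mem_cat => /or3P[/(allP Ui)|/inV ->|/(allP jT)] //=; by auto.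
exists (fun y s t => A y s t \/ [/\ y = x, s = i & t = j]); split.
- move=> k y c; rewrite !(mem_cat, inE) => /or4P[h|/eqP[-> -> _]|h|/orP[/eqP[-> -> _]|h]].
  + have [|s [r [h1 h2]]] := A1 k y c; first by rewrite mem_cat h.
    by exists s, r; split; [left|].
  + by exists i, j; split; [right|left].
  + have [|s [r [h1 h2]]] := A1 k y c; first by rewrite !mem_cat h !orbT.
    by exists s, r; split; [left|].
  + by exists i, j; split; [right|right].
  + have [|s [r [h1 h2]]] := A1 k y c; first by rewrite !mem_cat h !orbT.
    by exists s, r; split; [left|].
- move=> y s r [/A2[c [h1 h2 h3]]|[-> -> ->]].
    by exists c; split; rewrite ?sub.
  by exists b; split; rewrite // !(mem_cat, inE) eqxx ?orbT.
- move=> y z s r s' r' nyz [hA|[? ? ?]] [hB|[? ? ?]] hlt; subst.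
  + exact: (A3 y z s r s' r').
  + have [c [h1 h2 h3]] := A2 _ _ _ hA; rewrite indep_sym // in nyz.
    by have [] := endp _ _ _ h1 nyz; have [] := endp _ _ _ h2 nyz; lia.
  + have [c [h1 h2 h3]] := A2 _ _ _ hB.
    by have [] := endp _ _ _ h1 nyz; have [] := endp _ _ _ h2 nyz; lia.
  + lia.
Qed.

End Arcs.

(** * Image words stamped by source positions *)

Section TimedImage.
Variables (VL VG : finType) (phi : VL -> VG).

(** All letters of the image of one letter share its position as stamp, so an arc in the image is
    read as a pair of positions in [w]. *)
Fixpoint timed_image (k : nat) (w : word VG) : seq (nat * (VL * bool)) :=
  if w is x :: w' then
    [seq (k, y) | y <- phistar_letter phi x] ++ timed_image k.+1 w'
  else [::].

Lemma timed_imageE k w : [seq p.2 | p <- timed_image k w] = phistar phi w.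
Proof.
elim: w k => [|x w IH] k //=; rewrite map_cat IH -map_comp.
by rewrite /phistar /=; congr cat; rewrite -[RHS]map_id; apply: eq_map.
Qed.

Lemma mem_phistar_letter x j b : ((j, b) \in phistar_letter phi x) = (x == (phi j, b)).
Proof.
case: x => v c; rewrite /phistar_letter /= xpair_eqE.
have H d : ((j, b) \in [seq (v', d) | v' <- enum [pred v' | phi v' == v]]) = 
   (v == phi j) && (d == b).
  apply/mapP/andP => [[v' + [-> ->]]|[/eqP-> /eqP->]].
    by rewrite mem_enum inE => /eqP <-.
  by exists j; rewrite // mem_enum inE.
case: c; last exact: H.
by rewrite /inv_word mem_rev -map_comp; apply: H.
Qed.

Lemma mem_timed_image k w t j b d : ((t, (j, b)) \in timed_image k w) =
  (k <= t < k + size w) && (nth d w (t - k) == (phi j, b)).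
Proof.
elim: w k => [|x w IH] k /=; first by rewrite addn0 ltnNge andbN.
rewrite mem_cat IH; have -> : ((t, (j, b)) \in [seq (k, y) | y <- phistar_letter phi x]) =
   (t == k) && (x == (phi j, b)).
  rewrite -mem_phistar_letter; apply/mapP/andP => [[y hy [-> ->]]|[/eqP -> h]] //.
  by exists (j, b).
have [->|ntk] := eqVneq t k; first by rewrite subnn ltnn leqnn /= addnS ltnS leq_addr orbF.
case: (ltnP k t) => h; last by have -> : (k <= t) = false by lia.
by rewrite (ltnW h) addnS addSn -[t - k]prednK ?subn_gt0 //= -subnS.
Qed.

Lemma timed_image_sorted k w :
  pairwise (fun p q => p.1 <= q.1) (timed_image k w).
Proof.
elim: w k => [|x w IH] k //=; rewrite pairwise_cat IH andbT; apply/andP; split.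
  apply/allrelP => p q /mapP[y _ ->] /=; case: q => t [j b].
  by rewrite (mem_timed_image _ _ _ _ _ x) => /andP[/andP[/ltnW]].
by elim: (phistar_letter phi x) => //= y s ->; rewrite andbT all_map; apply/allP => z _ /=.
Qed.

End TimedImage.

(** Adjacency in the cycle without [%%], in a form suited to linear arithmetic. *)
Definition cycle_adj (m a b : nat) : Prop :=
  [\/ b = a.+1, a = b.+1, a = 0 /\ b = m.-1 | a = m.-1 /\ b = 0].

Lemma cycle_relP m (i j : 'I_m) : 1 < m ->
  cycle_rel m i j <-> cycle_adj m i j.
Proof.
move=> hm; have hi := ltn_ord i; have hj := ltn_ord j.
have succ (k : 'I_m) : k.+1 %% m = if k.+1 == m then 0 else k.+1.
  by case: eqP => [->|h]; rewrite ?modnn // modn_small //; have := ltn_ord k; lia.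
rewrite /cycle_rel !succ /cycle_adj /=; split.
  by case: ifP => h1; case: ifP => h2; case/orP => /eqP h; 
    do [by constructor 1; lia|by constructor 2; lia|by constructor 3; lia|by constructor 4; lia].
by case=> h; case: ifP => h1; case: ifP => h2; lia.
Qed.

Lemma between_dec (P : pred nat) s t :
  (exists2 r, s < r < t & P r) \/ (forall r, s < r < t -> ~~ P r).
Proof.
elim: t => [|t [[r hr Pr]|h]]; first by right=> r; lia.
  by left; exists r => //; lia.
have [st|ts] := ltnP s t; last by right=> r; lia.
case Pt: (P t); first by left; exists t => //; lia.
by right=> r hr; have [->|nrt] := eqVneq r t; [rewrite Pt|apply: h; lia].
Qed.

(** * Descent through nested arcs, with [L r] the vertex index of the letter at position [r] *)

Section ArcDescent.
Variables (m n size_w : nat) (L : nat -> nat) (A : nat -> nat -> nat -> Prop).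
Variable (G : Prop).
Hypothesis L_lt : forall r, r < size_w -> L r < m.
Hypothesis A_cover : forall j r, j < n -> r < size_w -> L r = j %% m ->
  exists s t, A j s t /\ (r = s \/ r = t).
Hypothesis A_ends : forall j s t, A j s t ->
  [/\ s < t < size_w, L s = j %% m & L t = j %% m].
Hypothesis A_cross : forall i j s t s' t', [\/ i = j, i = j.+1 | j = i.+1] ->
  A i s t -> A j s' t' -> ~ (s < s' < t /\ t < t').
Hypothesis A_reduced : forall j s t, A j s t ->
  (forall r, s < r < t -> ~ cycle_adj m (L s) (L r)) -> G.

(** The arc through [r] has an end strictly inside the given one. Non-crossing, applied in both
    orders, keeps its other end from leaving, so it is strictly shorter. *)
Lemma arc_nested i j s t r : A i s t -> s < r < t ->
  j < n -> L r = j %% m -> [\/ i = j, i = j.+1 | j = i.+1] ->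
  exists s' t', [/\ A j s' t', s <= s', t' <= t & t' - s' < t - s].
Proof.
move=> hA hr hj hL hij; have [ht _ _] := A_ends hA.
have [|s' [t' [hB hrB]]] := A_cover hj _ hL; first lia.
have [ht' _ _] := A_ends hB; exists s', t'.
have := A_cross hij hA hB.
have hji : [\/ j = i, j = i.+1 | i = j.+1].
  by case: hij; [constructor 1|constructor 3|constructor 2].
have := A_cross hji hB hA.
by case: hrB => ?; subst r; split=> //; lia.
Qed.

(* [g 0, ..., g k] are consecutive vertices of the path, with images
   [c 0, ..., c k], and [z] is the remaining vertex of the cycle. *)
Section Chain.
Variables (k z : nat) (g c : nat -> nat).
Hypothesis g_lt : forall i, i <= k -> g i < n.
Hypothesis g_col : forall i, i <= k -> c i = g i %% m.
Hypothesis g_adj : forall i, i < k -> g i = (g i.+1).+1 \/ g i.+1 = (g i).+1.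
Hypothesis c_adj : forall i a, i <= k -> a < m -> cycle_adj m (c i) a ->
  [\/ a = z, 0 < i /\ a = c i.-1 | i < k /\ a = c i.+1].

(** Induction on arc length. First pass to inner arcs of [g i] until no letter [c i] is enclosed;
    then an enclosed [c i.+1] gives an arc of [g i.+1] over no [c i], which restores the hypothesis.
    If there is none, no neighbour is enclosed and the ends cancel. *)
Lemma chain_descent i s t : i <= k -> A (g i) s t ->
  (forall r, s < r < t -> L r <> z) ->
  (forall r, s < r < t -> 0 < i -> L r <> c i.-1) -> G.
Proof.
move: {2}(t - s) (leqnn (t - s)) => N.
elim: N s t i => [|N IH] s t i hN hi hA hz hp.
  by have [h _ _] := A_ends hA; lia.
have [ht hs _] := A_ends hA.
have [[r hr /eqP hrc]|none] := between_dec (fun r => L r == c i) s t.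
  have [|||s' [t' [hB h1 h2 h3]]] := arc_nested (j := g i) hA hr.
  - exact: g_lt.
  - by rewrite hrc g_col.
  - by constructor 1.
  apply: (IH s' t' i) => //; first lia.
    by move=> q hq; apply: hz; lia.
  by move=> q hq; apply: hp; lia.
have [[r hr /andP[hik /eqP hrc]]|none'] :=
    between_dec (fun r => (i < k) && (L r == c i.+1)) s t.
  have [|||s' [t' [hB h1 h2 h3]]] := arc_nested (j := g i.+1) hA hr.
  - exact: g_lt.
  - by rewrite hrc g_col.
  - by case: (g_adj hik) => h; [constructor 2|constructor 3].
  apply: (IH s' t' i.+1) => //; first lia.
    by move=> q hq; apply: hz; lia.
  by move=> q hq _ /=; apply/eqP/none; lia.
apply: (A_reduced hA) => r hr; rewrite hs -g_col // => /(c_adj hi) [|h|[h1 h]|[h1 h]].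
- by apply: L_lt; lia.
- exact: (hz r hr h).
- exact: (hp r hr h1 h).
- by have := none' r hr; rewrite h1 h eqxx.
Qed.

Lemma chain_descent_all i s t : i <= k -> A (g i) s t ->
  (forall r, r < size_w -> L r <> z) -> G.
Proof.
elim: i s t => [|i IH] s t hi hA hz.
  by apply: (chain_descent hi hA) => // r hr; apply: hz; have [h _ _] := A_ends hA; lia.
have [[r hr /eqP hrc]|none] := between_dec (fun r => L r == c i) s t.
  have [h _ _] := A_ends hA.
  have [|||s' [t' [hB _]]] := @A_cover (g i) r; try lia; first by apply: g_lt; lia.
    by rewrite hrc g_col //; lia.
  by apply: (IH s' t') => //; lia.
apply: (chain_descent hi hA) => r hr; last by move=> _; apply/eqP/none.
by apply: hz; have [h _ _] := A_ends hA; lia.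
Qed.

End Chain.

Hypotheses (m_ge3 : 3 <= m) (n_ge : 2 * m - 2 <= n).

(** [down] lifts the cycle minus [v_(m-1)]; [up] lifts the cycle minus [v_(m-2)], with images
    [m-1, 0, ..., m-3]. The last vertex of [up] is [2m-3], which is where [2 * m - 2 <= n] is
    needed. *)
Let down i := m - 2 - i.
Let up i := m.-1 + i.
Let up_col i := if i == 0 then m.-1 else i.-1.

Let down_lt i : i <= m - 2 -> down i < n.
Proof. by rewrite /down; lia. Qed.

Let down_col i : i <= m - 2 -> down i = down i %% m.
Proof. by move=> hi; rewrite modn_small // /down; lia. Qed.

Let down_step i : i < m - 2 -> down i = (down i.+1).+1 \/ down i.+1 = (down i).+1.
Proof. by rewrite /down; lia. Qed.

Let down_adj i a : i <= m - 2 -> a < m -> cycle_adj m (down i) a ->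
  [\/ a = m.-1, 0 < i /\ a = down i.-1 | i < m - 2 /\ a = down i.+1].
Proof.
rewrite /down => hi ha [] h; last lia.
- by case: i hi h => [|i] hi h; [constructor 1|constructor 2]; lia.
- by constructor 3; lia.
- by constructor 1; lia.
Qed.

Let up_lt i : i <= m - 2 -> up i < n.
Proof. by rewrite /up; lia. Qed.

Let up_colE i : i <= m - 2 -> up_col i = up i %% m.
Proof.
rewrite /up /up_col; case: i => [|i] hi /=; first by rewrite addn0 modn_small //; lia.
by rewrite (_ : m.-1 + i.+1 = i + m); [rewrite modnDr modn_small //; lia | lia].
Qed.

Let up_step i : i < m - 2 -> up i = (up i.+1).+1 \/ up i.+1 = (up i).+1.
Proof. by rewrite /up; lia. Qed.

Let up_adj i a : i <= m - 2 -> a < m -> cycle_adj m (up_col i) a ->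
  [\/ a = m - 2, 0 < i /\ a = up_col i.-1 | i < m - 2 /\ a = up_col i.+1].
Proof.
rewrite /up_col; case: i => [|[|i]] /= hi ha [] h; try lia.
all: try by constructor 1; lia.
all: try by constructor 2; lia.
all: try by constructor 3; lia.
all: by have [?|?] := eqVneq a (m - 2); [constructor 1|constructor 3]; lia.
Qed.

(** The path vertices [m-2] and [m-1] are adjacent, so their arcs nest in alternation and shrink;
    the last one misses the other image and starts a chain. *)
Lemma middle_descent s t : A (m - 2) s t \/ A m.-1 s t -> G.
Proof.
move: {2}(t - s) (leqnn (t - s)) => N.
elim: N s t => [|N IH] s t hN.
  by case=> /A_ends[h _ _]; lia.
case=> hA; have [ht _ _] := A_ends hA.
- have [[r hr /eqP hrc]|none] := between_dec (fun r => L r == m.-1) s t.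
    have [|||s' [t' [hB h1 h2 h3]]] := arc_nested (j := m.-1) hA hr; first lia.
    + by rewrite modn_small //; lia.
    + by constructor 3; lia.
    + by apply: (IH s' t'); [lia|right].
  apply: (chain_descent down_lt down_col down_step down_adj (leq0n _)) (_ : A (down 0) s t) _ _ => //.
    by rewrite /down subn0.
  by move=> r hr; apply/eqP/none.
- have [[r hr /eqP hrc]|none] := between_dec (fun r => L r == m - 2) s t.
    have [|||s' [t' [hB h1 h2 h3]]] := arc_nested (j := m - 2) hA hr; first lia.
    + by rewrite modn_small //; lia.
    + by constructor 2; lia.
    + by apply: (IH s' t'); [lia|left].
  apply: (chain_descent up_lt up_colE up_step up_adj (leq0n _)) (_ : A (up 0) s t) _ _ => //.
    by rewrite /up addn0.
  by move=> r hr; apply/eqP/none.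
Qed.

Lemma arc_descent : 0 < size_w -> G.
Proof.
move=> hw; have L0 := L_lt hw.
have cover r : r < size_w -> exists s t, A (L r) s t.
  move=> hr; have Lr := L_lt hr.
  have [|||s [t [hA _]]] := @A_cover (L r) r => //; first lia.
    by rewrite modn_small.
  by exists s, t.
(* The interval of [between_dec] is open, so the shift by one lets [r.-1] run over all positions,
   including 0. *)
have [[r hr /eqP hrc]|none] := between_dec (fun r => L r.-1 == m.-1) 0 size_w.+1.
  have [|s [t hA]] := cover r.-1; first lia.
  by apply: (@middle_descent s t); right; rewrite -hrc.
have {}none r : r < size_w -> L r <> m.-1 by move=> hr; apply/eqP; apply: (none r.+1).
(* Without [v_(m-1)] the cycle is cut open, and any arc on [down] serves as a start. *)
have [s [t hA]] := cover 0 hw; have n0 := none 0 hw.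
apply: (chain_descent_all down_lt down_col down_step down_adj
  (i := m - 2 - L 0) (s := s) (t := t)) none; first lia.
by rewrite /down; have -> : m - 2 - (m - 2 - L 0) = L 0 by lia.
Qed.

End ArcDescent.

(** * Reducible words and the kernel *)

Lemma eq_cat_nth2 (T : Type) (d : T) (w : seq T) s t : s < t < size w ->
  w = take s w ++ nth d w s :: take (t - s.+1) (drop s.+1 w) ++ nth d w t :: drop t.+1 w.
Proof.
case/andP=> st tw; rewrite -{1}(cat_take_drop s w); congr cat.
rewrite (drop_nth d (ltn_trans st tw)); congr cons.
rewrite -{1}(cat_take_drop (t - s.+1) (drop s.+1 w)); congr cat.
by rewrite drop_drop subnK // (drop_nth d).
Qed.

Section Phistar.
Variables (VL VG : finType) (eL : rel VL) (eG : rel VG) (phi : VL -> VG).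

Lemma phistar_cat w1 w2 : phistar phi (w1 ++ w2) = phistar phi w1 ++ phistar phi w2.
Proof. by rewrite /phistar map_cat flatten_cat. Qed.

Lemma phistar_letterV x b :
  phistar_letter phi (x, ~~ b) = inv_word (phistar_letter phi (x, b)).
Proof. by case: b; rewrite /phistar_letter //= inv_wordK. Qed.

Lemma phistar_cons x w : phistar phi (x :: w) = phistar_letter phi x ++ phistar phi w.
Proof. by []. Qed.

Lemma phistar_inv w : phistar phi (inv_word w) = inv_word (phistar phi w).
Proof.
elim: w => [|[x b] w IH] //=.
rewrite inv_word_cons phistar_cat IH !phistar_cons inv_word_cat cats0.
by rewrite phistar_letterV.
Qed.

Lemma mem_phistar (p : VL * bool) w : p \in phistar phi w -> (phi p.1, p.2) \in w.
Proof.
case/flattenP=> s /mapP[x xw ->]; case: p => j b.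
by rewrite mem_phistar_letter => /eqP <-.
Qed.

(** A graph map preserves edges, so lifts of non-adjacent vertices are non-adjacent and commute. *)
Lemma phistar_conj x b v : graph_map eL eG phi -> all (fun p => ~~ eG x p.1) v ->
  geq eL (phistar phi ((x, b) :: v ++ [:: (x, ~~ b)])) (phistar phi v).
Proof.
move=> hphi hv; rewrite phistar_cons phistar_cat phistar_cons cats0 phistar_letterV.
apply: geq_conj; apply/allP => -[j c]; rewrite mem_phistar_letter => /eqP[xj _].
apply/allP => q /mem_phistar /(allP hv) /=; rewrite xj; apply: contra; exact: hphi.
Qed.

Lemma phistar_ker_injective :
  (forall w, geq eL (phistar phi w) [::] -> geq eG w [::]) ->
  phistar_injective eL eG phi.
Proof.
move=> hker w1 w2 h; apply/geq_eq1/hker; rewrite phistar_cat phistar_inv.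
by apply: geq_trans (geq_mulV eL (phistar phi w2)); apply: geq_catr.
Qed.

Definition reducible (w : word VG) := exists u x b v t,
  w = u ++ (x, b) :: v ++ (x, ~~ b) :: t /\ all (fun p => ~~ eG x p.1) v.

(** Deleting a cancelling pair changes neither the class of [w] nor that of its image, so induction
    on length empties a kernel word. *)
Lemma phistar_injective_of_reducible : graph_map eL eG phi ->
  (forall w, w <> [::] -> geq eL (phistar phi w) [::] -> reducible w) ->
  phistar_injective eL eG phi.
Proof.
move=> hphi hred; apply: phistar_ker_injective => w.
move: {2}(size w) (leqnn (size w)) => N; elim: N w => [|N IH] w hN h.
  by move: hN; rewrite leqn0 size_eq0 => /eqP ->; apply: geq_refl.
have [->|/eqP w0] := eqVneq w [::]; first exact: geq_refl.
have [u [x [b [v [t [ew hv]]]]]] := hred w w0 h.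
have eqG : geq eG w (u ++ v ++ t).
  have := geq_cat2 u t (geq_conj1 b hv); rewrite ew.
  by rewrite /= -catA.
apply: geq_trans eqG _; apply: IH.
  by move: hN; rewrite ew !size_cat /= size_cat /=; lia.
apply: geq_trans h; apply: geq_sym.
have := geq_cat2 (phistar phi u) (phistar phi t) (phistar_conj b hphi hv).
by rewrite ew -!phistar_cat /= -catA.
Qed.
End Phistar.

(** * Long paths: injectivity *)

Lemma path_rel_sym n : symmetric (path_rel n).
Proof. by move=> i j; rewrite /path_rel orbC. Qed.

Lemma phi_nm_graph_map m n (hm : 0 < m) :
  graph_map (path_rel n) (cycle_rel m) (phi_nm n m hm).
Proof.
have modS a : (a %% m).+1 %% m = a.+1 %% m by rewrite -addn1 modnDml addn1.
move=> i j; rewrite /path_rel /cycle_rel /= !modS => /orP[/eqP->|/eqP->]; by rewrite eqxx ?orbT.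
Qed.

Lemma phi_nm_reducible m n (hm : 0 < m) (w : word 'I_m) : 3 <= m -> 2 * m - 2 <= n ->
  w <> [::] -> geq (path_rel n) (phistar (phi_nm n m hm) w) [::] ->
  reducible (cycle_rel m) w.
Proof.
move=> m3 hn w0 /(cancels_geq (@path_rel_sym n)) [_ /(_ (cancels_nil _)) hW].
have [A [A1 A2 A3]] := cancels_arc_system (@path_rel_sym n) hW
  (timed_imageE _ 0 w) (timed_image_sorted _ 0 w).
pose d : 'I_m * bool := (Ordinal hm, false).
pose L r : nat := (nth d w r).1.
pose B j s t := exists hj : j < n, A (Ordinal hj) s t.
have memE r j b : ((r, (j, b)) \in timed_image (phi_nm n m hm) 0 w) =
    (r < size w) && (nth d w r == (phi_nm n m hm j, b)).
  by rewrite (mem_timed_image _ _ _ _ _ _ d) subn0 add0n.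
have B_ends j s t : B j s t -> 
   exists c b, [/\ s < t < size w, L s = j %% m, L t = j %% m, 
      nth d w s = (c, b) & nth d w t = (c, ~~ b)].
  case=> hj /A2[b []]; rewrite !memE => /andP[sw /eqP hs] /andP[tw /eqP ht] st.
  exists (phi_nm n m hm (Ordinal hj)), b; rewrite /L hs ht tw; split=> //=.
  (* The ends of an arc carry opposite signs, so they come from different positions of [w]. *)
  rewrite andbT ltn_neqAle st andbT; apply: contra_eq_neq hs => ->.
  by rewrite ht xpair_eqE; case: b {ht} => /=; rewrite andbF.
apply: (@arc_descent m n (size w) L B (reducible _ w)) => //.
- by move=> r _; apply: ltn_ord.
- move=> j r hj hr hL.
  have [|s [t [hA h]]] := A1 r (Ordinal hj) (nth d w r).2; last by exists s, t; split=> //; exists hj.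
  by rewrite memE hr [nth _ _ _]surjective_pairing xpair_eqE eqxx andbT -val_eqE /= -hL /L /=.
- by move=> j s t /B_ends[c [b []]].
- move=> i j s t s' t' hij [hi hA] [hj hB]; apply: A3 hA hB.
  rewrite /indep -val_eqE /path_rel /=.
  by case: hij => ->; rewrite eqxx ?andbF ?orbT ?andbF.
- move=> j s t /B_ends[c [b [hst _ _ hs ht]]] hr.
  exists (take s w), c, b, (take (t - s.+1) (drop s.+1 w)), (drop t.+1 w); split.
    by rewrite -ht -hs -eq_cat_nth2.
  apply/(all_nthP d) => k; rewrite size_takel; last by rewrite size_drop; lia.
  move=> hk; rewrite nth_take // nth_drop; apply/negP => /cycle_relP -/(_ (ltnW m3)) h.
  by apply: (hr (s.+1 + k)); [lia | rewrite /L hs].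
- by case: w w0 {hW A1 A2 memE L B B_ends}.
Qed.

(** * Short paths: a kernel element *)

Fixpoint nested_commutator (V : Type) (v : nat -> V) (z : V) (k : nat) : word V :=
  if k is i.+1 then
    (v i, false) :: nested_commutator v z i ++
      (v i, true) :: inv_word (nested_commutator v z i)
  else [:: (z, false)].

(** A conjugating letter in [P] joins the word; any other commutes with all of [P] and
    disappears. *)
Lemma geq_conj_support (V : finType) (e : rel V) (P : pred V) (a d : word V) :
  all (fun p => P p.1) d ->
  (forall p, p \in a -> P p.1 \/ forall y, P y -> ~~ e p.1 y) ->
  exists2 d', geq e (a ++ d ++ inv_word a) d' & all (fun p => P p.1) d'.
Proof.
move=> hd; elim: a => [|[x b] a IH] ha.
  by exists d; rewrite //= cats0; apply: geq_refl.
have [|d' hd' Pd'] := IH; first by move=> p pa; apply: ha; rewrite inE pa orbT.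
have step : geq e (((x, b) :: a) ++ d ++ inv_word ((x, b) :: a))
    ((x, b) :: d' ++ [:: (x, ~~ b)]).
  rewrite inv_word_cons !catA -(catA _ d).
  exact: (geq_cat2 [:: (x, b)] [:: (x, ~~ b)] hd').
have [Px|hx] := ha (x, b) (mem_head _ _).
  by exists ((x, b) :: d' ++ [:: (x, ~~ b)]); rewrite //= all_cat /= Px Pd'.
exists d' => //; apply: geq_trans step _; apply: geq_conj1.
by apply: sub_all Pd' => p; apply: hx.
Qed.

Section ShortPath.
Variables (m n : nat) (hm : 0 < m).
Hypotheses (m_ge3 : 3 <= m) (n_lt : n < 2 * m - 2).

Let v (i : nat) : 'I_m := Ordinal (ltn_pmod i hm).
(** The outermost letter of [c k] is [v (k - 1)], so [c (m - 2)] uses every generator except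
    [v (m - 2)]. *)
Let c k := nested_commutator v (v m.-1) k.
Let phi := phi_nm n m hm.

Let fiberE (j : 'I_n) i : i < m -> phi j = v i -> j = i :> nat \/ j = i + m :> nat.
Proof.
move=> hi /(congr1 val) /=; have hj := ltn_ord j; rewrite (modn_small hi).
have [jm|mj] := ltnP j m; first by rewrite modn_small //; left.
by rewrite -{1}(subnK mj) modnDr modn_small; [right|]; lia.
Qed.

Let phistar_c i : phistar phi (c i.+1) =
  phistar_letter phi (v i, false) ++ phistar phi (c i)
    ++ inv_word (phistar_letter phi (v i, false)) ++ inv_word (phistar phi (c i)).
Proof.
rewrite /c /= phistar_cons phistar_cat phistar_cons phistar_inv.
by rewrite (phistar_letterV _ (v i) false).
Qed.

(** Of the possible lifts of [v i], the vertex [i] lies at least two below the window and commutes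
    with it, while [i + m] extends the window by one on the right. *)
Lemma phistar_nested_commutator_support i : i <= m - 3 ->
  exists2 d, geq (path_rel n) (phistar phi (c i)) d
           & all (fun p : 'I_n * bool => m.-1 <= p.1 <= m.-1 + i) d.
Proof.
elim: i => [_|i IH hi].
  exists (phistar phi (c 0)); first exact: geq_refl.
  apply/allP => p; rewrite /c /= phistar_cons cats0; case: p => j b.
  rewrite mem_phistar_letter xpair_eqE => /andP[/eqP/esym/fiberE + _] /=.
  by have := ltn_ord j; lia.
have [|d hd Pd] := IH; first lia.
pose P (y : 'I_n) := m.-1 <= y <= m.-1 + i.+1.
have Pd' : all (fun p => P p.1) d by apply: sub_all Pd => p; rewrite /P; lia.
have [|d1 hd1 Pd1] := @geq_conj_support _ (path_rel n) P
    (phistar_letter phi (v i, false)) d Pd'.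
  move=> [j b]; rewrite mem_phistar_letter xpair_eqE => /andP[/eqP/esym/fiberE + _] /=.
  case=> [|hj|hj]; first lia; last by left; rewrite /P; lia.
  by right=> y; rewrite /P /path_rel /= hj; lia.
exists (d1 ++ inv_word d).
  rewrite phistar_c; apply: geq_trans (geq_cat hd1 (geq_inv hd)).
  by rewrite -!catA; apply: geq_cat2.
rewrite all_cat Pd1 /inv_word all_rev all_map.
exact: sub_all Pd'.
Qed.

Lemma phistar_nested_commutator_trivial : geq (path_rel n) (phistar phi (c (m - 2))) [::].
Proof.
have [d hd Pd] := phistar_nested_commutator_support (leqnn _).
have -> : m - 2 = (m - 3).+1 by lia.
rewrite phistar_c; apply: geq_trans (geq_mulV (path_rel n) d).
set a := phistar_letter _ _.
have ha : geq (path_rel n) (a ++ d ++ inv_word a) d.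
  apply: geq_conj; apply/allP => -[j b].
  rewrite mem_phistar_letter xpair_eqE => /andP[/eqP/esym/fiberE + _] /=.
  (* The second lift of [v (m - 3)] would be [2 * m - 3], which is not below [n]; the first is two
     below the window. *)
  case=> [|hj|hj]; [lia| |by have := ltn_ord j; lia].
  by apply: sub_all Pd => p; rewrite /path_rel /= hj; lia.
apply: geq_trans (geq_cat ha (geq_inv hd)).
by rewrite -!catA; apply: geq_cat2.
Qed.

(** * Transvections over the field with two elements *)

Definition transvection (p : nat) (f : nat -> bool) (k : nat) : bool :=
  if k == p.+1 then f k (+) f p else f k.

(* [v_i] sits at coordinate [i + 1 mod m]; the last one, [v_(m-2)], acts trivially. *)
Definition letter_act (x : 'I_m) (f : nat -> bool) : nat -> bool :=
  if val x == m - 2 then f else transvection (x.+1 %% m) f.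

Definition word_act (w : word 'I_m) (f : nat -> bool) : nat -> bool :=
  foldr (fun y => letter_act y.1) f w.

Let act_ext w f g : f =1 g -> word_act w f =1 word_act w g.
Proof.
move=> fg; elim: w => //= x w IH k.
by rewrite /letter_act; case: ifP => _ //; rewrite /transvection !IH.
Qed.

Let act_cat w1 w2 f : word_act (w1 ++ w2) f = word_act w1 (word_act w2 f).
Proof. exact: foldr_cat. Qed.

Let letter_actK x f : letter_act x (letter_act x f) =1 f.
Proof.
move=> k; rewrite /letter_act; case: (val x == m - 2) => //.
by rewrite /transvection /= (ltn_eqF (ltnSn _)); case: eqP => // _; rewrite addbK.
Qed.

(** Neither transvection changes the coordinate that the other one reads. *)
Let transvection_comm p q f : p != q.+1 -> q != p.+1 ->
  transvection p (transvection q (transvection p (transvection q f))) =1 f.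
Proof.
rewrite /transvection => /negbTE pq /negbTE qp k.
rewrite /= pq qp !(ltn_eqF (ltnSn _)).
by do !case: eqP => ? //; case: (f k) (f p) (f q) => -[] [].
Qed.

Let letter_act_comm x y f : ~~ cycle_rel m x y ->
  letter_act x (letter_act y (letter_act x (letter_act y f))) =1 f.
Proof.
move=> nxy k; rewrite /letter_act.
case: (eqVneq (val x) (m - 2)) => hx; first exact: (letter_actK y f k).
case: (eqVneq (val y) (m - 2)) => hy.
  by have := letter_actK x f k; rewrite /letter_act (negbTE hx).
have succ (z : 'I_m) : z.+1 %% m = if z == m.-1 :> nat then 0 else z.+1.
  case: eqP => [->|h]; first by rewrite prednK // modnn.
  by rewrite modn_small //; have := ltn_ord z; lia.
have nadj : ~ cycle_adj m x y.
  by move/(cycle_relP x y (ltnW m_ge3)); apply/negP.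
have hx' := ltn_ord x; have hy' := ltn_ord y.
apply: transvection_comm; rewrite !succ; apply/negP => /eqP h; apply: nadj; move: h;
  case: eqP => h1; case: eqP => h2 h3; try lia.
all: try by constructor 1; lia.
all: try by constructor 2; lia.
all: try by constructor 3; lia.
all: try by constructor 4; lia.
Qed.

Lemma word_act_geq w1 w2 : geq (cycle_rel m) w1 w2 ->
  forall f, word_act w1 f =1 word_act w2 f.
Proof.
elim=> {w1 w2} [w|w1 w2 _ IH|w1 w2 w3 _ IH1 _ IH2|u w x b|u w x y exy] f k //.
- by rewrite IH.
- by rewrite IH1 IH2.
- by rewrite !act_cat; apply: act_ext => {}k; apply: letter_actK.
- by rewrite !act_cat; apply: act_ext => {}k; apply: letter_act_comm.
Qed.

(** Steinberg's relation: adding coordinate 0 to [i + 1] and coordinate [i + 1] to [i + 2] have as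
    commutator adding coordinate 0 to [i + 2]. *)
Let act_c i : i <= m - 2 -> forall f k,
  word_act (c i) f k = if k == i.+1 then f k (+) f 0 else f k.
Proof.
elim: i => [_|i IH hi] f k.
  rewrite /c /= /letter_act /= (modn_small (_ : m.-1 < m)) ?prednK // modnn.
  by case: eqP => // h; lia.
have {}IH := IH (ltnW hi).
have IHV g : word_act (inv_word (c i)) g =1 word_act (c i) g.
  move=> l; have cK h : word_act (c i) (word_act (c i) h) =1 h.
    by move=> l'; rewrite !IH; case: eqP => // _; rewrite /= addbK.
  rewrite -[LHS]cK; apply: act_ext => l'.
  by rewrite -act_cat (word_act_geq (geq_mulV _ _)).
have vi g : letter_act (v i) g = transvection i.+1 g.
  rewrite /letter_act /= (modn_small (_ : i < m)); last lia.
  by rewrite modn_small; [case: eqP => // h|]; lia.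
rewrite /c /= act_cat /= !vi -/(c i) /transvection.
rewrite !(IH, IHV) eqxx (ltn_eqF (ltnSn i.+1)) /=.
have [->|_] := eqVneq k i.+2; last by case: eqP => // _; rewrite addbK.
rewrite (gtn_eqF (ltnSn i.+1)).
by case: (f _) (f _) (f _) => -[] [].
Qed.

Lemma nested_commutator_nontrivial : ~ geq (cycle_rel m) (c (m - 2)) [::].
Proof.
(* The unit vector at 0 acquires a nonzero coordinate at [(m - 2) + 1 = m - 1]. *)
move=> /word_act_geq /(_ (fun k => k == 0) m.-1); rewrite act_c //=.
by case: eqP; case: eqP; lia.
Qed.

Lemma phi_nm_not_injective :
  ~ phistar_injective (path_rel n) (cycle_rel m) phi.
Proof. by move=> /(_ (c (m - 2)) [::] phistar_nested_commutator_trivial) /nested_commutator_nontrivial. Qed.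

End ShortPath.

Theorem theorem3p16 (m n : nat) (hm : 3 <= m) (hn : 1 <= n) :
  phistar_injective (path_rel n) (cycle_rel m) (phi_nm n m (ltnW (ltnW hm)))
  <-> 2 * m - 2 <= n.
Proof.
split=> [hinj|hmn].
  by rewrite leqNgt; apply/negP => h; apply: (@phi_nm_not_injective m n _ hm h hinj).
apply: phistar_injective_of_reducible; first exact: phi_nm_graph_map.
by move=> w; apply: phi_nm_reducible.
Qed.
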